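(* Let $H$ be an infinite dimensional Hilbert space, let $u,v\in H$ be fixed orthogonal vectors of norm one, and let $T=[(T_\varepsilon)]\in\mathcal{B}(\mathcal{G}_H)$ be a selfadjoint operator such that each $T_\varepsilon$ is selfadjoint. Put $\nu(T)=[\varepsilon\mapsto|\langle u,\exp(iT_\varepsilon)v\rangle|]\in\overline{\mathbb{R}}$ and, for $T_0\in\mathcal{B}(H)$, $\nu(T_0)=|\langle u,\exp(iT_0)v\rangle|\in\mathbb{R}$. Then $$\mathrm{supp}(\nu(T))=\{\nu(T_0):T_0\in\mathrm{supp}(T)\}.$$
   Context: Let $\mathbb{K}\in\{\mathbb{R},\mathbb{C}\}$ and $I=\,]0,1]$. For a normed space $E$, a net $(x_\varepsilon)\in E^I$ is moderate if there is $n\in\mathbb{Z}$ with $\|x_\varepsilon\|\le\varepsilon^n$ for all small $\varepsilon$, and null if for each $q\in\mathbb{N}$, $\|x_\varepsilon\|\le\varepsilon^q$ for all small $\varepsilon$; $\mathcal{G}_E$ denotes moderate nets modulo null nets, and $\overline{\mathbb{K}}=\mathcal{G}_{\mathbb{K}}$ is the ring of Colombeau generalized numbers. $\mathcal{G}_H$ is a $\overline{\mathbb{K}}$-module. $\mathcal{B}(H)$ is the space of bounded linear operators on $H$ with the operator norm. A basic map $T=[(T_\varepsilon)]:\mathcal{G}_H\to\mathcal{G}_H$ is one given by a net of bounded operators $T_\varepsilon\in\mathcal{B}(H)$, moderate in operator norm, via $T[(x_\varepsilon)]=[(T_\varepsilon x_\varepsilon)]$. $\mathcal{B}(\mathcal{G}_H)$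 denotes the set of compactly supported elements: those $T:\mathcal{G}_H\to\mathcal{G}_H$ having a representative $(T_\varepsilon)$ for which there exist a compact subset $K\subset\mathcal{B}(H)$ and $\eta\in I$ with $T_\varepsilon\in K$ for all $\varepsilon<\eta$. The support of $T$ is $\mathrm{supp}(T)=\{T_0\in\mathcal{B}(H):\exists\, e=e^2\in\overline{\mathbb{K}},\ e\ne0,\ e\cdot T\approx e\cdot T_0\}$, where $e\cdot T\approx e\cdot T_0$ means $\|e_\varepsilon(T_\varepsilon-T_0)\|\to0$ (operator norm) as $\varepsilon\to0$; every idempotent $e$ of $\overline{\mathbb{K}}$ is the class of the characteristic function of a subset $S\subset I$, and $e\neq 0$ iff $0\in\overline{S}$. The support of a generalized number $p=[(p_\varepsilon)]$ is $\mathrm{supp}(p)=\{q:\exists\,\varepsilon_k\to0,\ p_{\varepsilon_k}\to q\}$. *)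

(* Defs.v *)
From HB Require Import structures.
From mathcomp Require Import all_boot all_order all_algebra.
From mathcomp Require Import lra.
From mathcomp Require Import ring_quotient sesquilinear complex.
From mathcomp Require Import all_classical all_reals all_analysis.

Set Implicit Arguments.
Unset Strict Implicit.
Unset Printing Implicit Defensive.

Import Order.TTheory GRing.Theory Num.Theory.
Import numFieldNormedType.Exports.

Local Open Scope classical_set_scope.
Local Open Scope ring_scope.
Local Open Scope quotient_scope.

(* A form of type {dot H for conjC} is linear in its first argument and
   conjugate-linear in its second one. *)
HB.mixin Record NormedModule_isHilbert (R : realType) H
    & NormedModule R[i] H := {
  hdot : {dot H for (@Num.conj R[i])} ;
  hdot_norm : forall x : H, hdot x x = `|x| ^+ 2
}.

#[short(type="hilbertType")]
HB.structure Definition Hilbert (R : realType) :=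
  {H of CompleteNormedModule R[i] H & NormedModule_isHilbert R H}.

Definition infinite_dimensional (K : numFieldType) (E : lmodType K) : Prop :=
  ~ exists (n : nat) (b : 'I_n -> E),
      forall x, exists c : 'I_n -> K, x = \sum_(i < n) c i *: b i.

Section BoundedOperators.
Variables (R : realType) (H : normedModType R[i]).

Definition bounded_linear (f : H -> H) : Prop :=
  linear f /\ exists M : R[i], forall x, `|f x| <= M * `|x|.

Definition bop_pred : {pred H -> H} := fun f => `[< bounded_linear f >].

Record bop := Bop { bop_fun :> H -> H ; _ : bop_fun \in bop_pred }.

HB.instance Definition _ := [isSub of bop for bop_fun].
HB.instance Definition _ := [Choice of bop by <:].

Lemma bop_subproof (A : bop) : bounded_linear A.
Proof. by case: A => A /= /asboolP. Qed.

Lemma bop_pred_submod : submod_closed bop_pred.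
Proof.
split; first by apply/asboolP; split=> [a x y|]; [rewrite /= scaler0 addr0|
  exists 0 => x; rewrite mul0r normr0].
move=> a f g /asboolP[lf [M fM]] /asboolP[lg [N gN]]; apply/asboolP; split.
  move=> c x y; rewrite !fctE lf lg !scalerDr addrACA; congr (_ + _).
  by rewrite !scalerA mulrC.
exists (`|a| * M + N) => x; rewrite !fctE (le_trans (ler_normD _ _))// mulrDl.
by rewrite lerD// normrZ -mulrA ler_wpM2l.
Qed.

HB.instance Definition _ := GRing.isSubmodClosed.Build R[i] (H -> H) bop_pred
  bop_pred_submod.
HB.instance Definition _ := [SubChoice_isSubLmodule of bop by <:].

HB.instance Definition _ (A : bop) :=
  GRing.isLinear.Build R[i] H H _ A (bop_subproof A).1.

Lemma bop_addE (A B : bop) x : (A + B) x = A x + B x. Proof. by []. Qed.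
Lemma bop_oppE (A : bop) x : (- A) x = - A x. Proof. by []. Qed.
Lemma bop_scaleE a (A : bop) x : (a *: A) x = a *: A x. Proof. by []. Qed.
Lemma bop_ext (A B : bop) : A =1 B -> A = B.
Proof. by move=> AB; apply/val_inj/funext. Qed.

(* The norm of H takes its values in R[i]; the supremum is taken in R. *)
Definition opnorm (A : bop) : R :=
  sup [set complex.Re `|A x| | x in [set x : H | `|x| <= 1]].

Let ReK (z : R[i]) : 0 <= z -> (complex.Re z)%:C%C = z.
Proof. by case: z => a b; rewrite lecE /= => /andP[/eqP-> _]. Qed.

Let has_sup_opnorm (A : bop) :
  has_sup [set complex.Re `|A x| | x in [set x : H | `|x| <= 1]].
Proof.
split; first by exists (complex.Re `|A 0|), 0 => //=; rewrite normr0 ler01.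
have [_ [M AM]] := bop_subproof A.
exists (complex.Re `|M|) => _ [x x1 <-].
rewrite -lecR !ReK// (le_trans (AM x))//.
have [->|x0] := eqVneq x 0; first by rewrite normr0 mulr0.
have M0 : 0 <= M.
  by rewrite -(@pmulr_lge0 _ `|x|) ?normr_gt0// (le_trans _ (AM x)).
by rewrite ger0_norm// ler_piMr.
Qed.

Lemma opnormP (A : bop) x : `|A x| <= (opnorm A)%:C%C * `|x|.
Proof.
have [->|x0] := eqVneq x 0; first by rewrite linear0 !normr0 mulr0.
have nx0 : 0 < `|x| by rewrite normr_gt0.
rewrite -ler_pdivrMr// -[X in X <= _]ReK ?divr_ge0// lecR.
apply: sup_upper_bound; first exact: has_sup_opnorm.
exists (`|x|^-1 *: x) => /=; last first.
  by rewrite linearZ normrZ ger0_norm ?invr_ge0// mulrC.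
by rewrite normrZ ger0_norm ?invr_ge0// mulVf ?gt_eqF.
Qed.

Lemma opnorm_le (A : bop) (M : R) : 0 <= M ->
  (forall x, `|A x| <= M%:C%C * `|x|) -> opnorm A <= M.
Proof.
move=> M0 AM; apply: ge_sup; first by have [] := has_sup_opnorm A.
move=> _ [x /= x1 <-]; rewrite -lecR ReK// (le_trans (AM x))//.
by rewrite ler_piMr// ler0c.
Qed.

Lemma opnorm_ge0 (A : bop) : 0 <= opnorm A.
Proof.
apply: le_trans (sup_upper_bound (has_sup_opnorm A) _); last first.
  by exists 0 => //=; rewrite normr0 ler01.
by rewrite linear0 normr0.
Qed.

Let opnormD (A B : bop) :
  (opnorm (A + B))%:C%C <= (opnorm A)%:C%C + (opnorm B)%:C%C :> R[i].
Proof.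
rewrite -rmorphD lecR; apply: opnorm_le => [|x].
  by rewrite addr_ge0 ?opnorm_ge0.
by rewrite (le_trans (ler_normD _ _))// rmorphD mulrDl lerD ?opnormP.
Qed.

Let opnormZ_le a (A : bop) : (opnorm (a *: A))%:C%C <= `|a| * (opnorm A)%:C%C.
Proof.
have [r aE r0] : exists2 r : R, `|a| = r%:C%C & 0 <= r.
  by exists (complex.Re `|a|); rewrite -?ler0c ReK.
rewrite aE -rmorphM lecR; apply: opnorm_le => [|x].
  by rewrite mulr_ge0 ?opnorm_ge0.
by rewrite normrZ rmorphM aE -mulrA ler_wpM2l ?opnormP// ler0c.
Qed.

Let opnormZ a (A : bop) : (opnorm (a *: A))%:C%C = `|a| * (opnorm A)%:C%C.
Proof.
have [->|a0] := eqVneq a 0.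
  rewrite scale0r normr0 mul0r; apply/eqP; rewrite eq_le ler0c opnorm_ge0 andbT.
  by have := opnormZ_le 0 0; rewrite scale0r normr0 mul0r.
apply/eqP; rewrite eq_le opnormZ_le/= -ler_pdivlMl ?normr_gt0//.
by rewrite -normfV -[in X in X <= _](scalerK a0 A) opnormZ_le.
Qed.

Let opnorm_eq0 (A : bop) : (opnorm A)%:C%C = 0 :> R[i] -> A = 0.
Proof.
move=> A0; apply: bop_ext => x; apply/eqP; rewrite -normr_le0.
by rewrite (le_trans (opnormP A x))// A0 mul0r.
Qed.

HB.instance Definition _ := Lmodule_isNormed.Build R[i] bop
  opnormD opnormZ opnorm_eq0.

Lemma bop_normE (A : bop) : `|A| = (opnorm A)%:C%C. Proof. by []. Qed.

Lemma bop_normP (A : bop) x : `|A x| <= `|A| * `|x|.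
Proof. exact: opnormP. Qed.

Fact bid_subproof : (id : H -> H) \in bop_pred.
Proof. by apply/asboolP; split=> //; exists 1 => x; rewrite mul1r. Qed.
Definition bid : bop := Bop bid_subproof.

Fact bcomp_subproof (A B : bop) : (A \o B : H -> H) \in bop_pred.
Proof.
apply/asboolP; split; first by move=> a x y /=; rewrite !linearP.
exists (`|A| * `|B|) => x /=; rewrite (le_trans (bop_normP _ _))// -mulrA.
by rewrite ler_wpM2l ?bop_normP.
Qed.
Definition bcomp (A B : bop) : bop := Bop (bcomp_subproof A B).

Let bcompA : associative bcomp. Proof. by move=> A B C; apply: bop_ext. Qed.
Let bcomp1l : left_id bid bcomp. Proof. by move=> A; apply: bop_ext. Qed.
Let bcomp1r : right_id bid bcomp. Proof. by move=> A; apply: bop_ext. Qed.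
Let bcompDl : left_distributive bcomp +%R.
Proof. by move=> A B C; apply: bop_ext. Qed.
Let bcompDr : right_distributive bcomp +%R.
Proof. by move=> A B C; apply: bop_ext => x; exact: (linearD A). Qed.

HB.instance Definition _ := GRing.Zmodule_isPzRing.Build bop
  bcompA bcomp1l bcomp1r bcompDl bcompDr.

Definition bop_exp (A : bop) : bop :=
  limn (series (fun n => (n`!%:R : R[i])^-1 *: A ^+ n)).

End BoundedOperators.

Definition bop_selfadjoint (R : realType) (H : hilbertType R) (A : bop H) :=
  forall x y : H, hdot (A x) y = hdot x (A y).

Inductive scalars := RealScalars | ComplexScalars.

Definition scal (R : realType) (k : scalars) : numFieldType :=
  match k with RealScalars => R | ComplexScalars => R[i] end.

Definition of_real (R : realType) (k : scalars) : R -> scal R k :=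
  match k with RealScalars => id | ComplexScalars => real_complex R end.

Definition epsI (R : realType) := {eps : R | 0 < eps <= 1}.

Section Index.
Variable R : realType.

Fact one_epsI_subproof : 0 < (1 : R) <= 1. Proof. by rewrite ltr01 lexx. Qed.

HB.instance Definition _ := Choice.on (epsI R).
HB.instance Definition _ := isPointed.Build (epsI R)
  (exist (fun x : R => is_true (0 < x <= 1)) 1 one_epsI_subproof).

(* The filter eps --> 0 on ]0, 1] *)
Definition to_zero : set_system (epsI R) :=
  [set P | exists2 eta : R, 0 < eta & forall eps, val eps < eta -> P eps].

Global Instance to_zero_filter : ProperFilter to_zero.
Proof.
split; [|split].
- move=> [eta eta0] /=.
  have eps01 : 0 < Num.min (eta / 2) 1 <= 1.
    by rewrite lt_min divr_gt0//= ltr01 ge_min lexx orbT.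
  move/(_ (exist (fun x : R => is_true (0 < x <= 1)) _ eps01)); apply => /=.
  by rewrite gt_min ltr_pdivrMr// ltr_pMr// ltr1n.
- by exists 1.
- move=> P Q [a a0 aP] [b b0 bQ]; exists (Num.min a b).
    by rewrite lt_min a0.
  by move=> eps; rewrite lt_min => /andP[/aP Pe /bQ].
- by move=> P Q PQ [a a0 aP]; exists a => // eps /aP /PQ.
Qed.

End Index.
Arguments to_zero {R}.

Section Colombeau.
Variables (R : realType) (k : scalars).
Local Notation K := (scal R k).

Lemma of_realD (a b : R) : of_real k (a + b) = of_real k a + of_real k b.
Proof. by case: k => //=; exact: (rmorphD (real_complex R)). Qed.
Lemma of_realM (a b : R) : of_real k (a * b) = of_real k a * of_real k b.
Proof. by case: k => //=; exact: (rmorphM (real_complex R)). Qed.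
Lemma of_real0 : of_real k 0 = 0 :> K. Proof. by case: k. Qed.
Lemma of_real1 : of_real k 1 = 1 :> K. Proof. by case: k. Qed.
Lemma ler_of_real (a b : R) : (of_real k a <= of_real k b) = (a <= b).
Proof. by case: k => //=; exact: lecR. Qed.

Let ler_exp (eps : epsI R) (m n : int) : m <= n ->
  val eps ^ n <= val eps ^ m.
Proof.
case: eps => e /= /andP[e0 e1] mn.
have -> : n = m + `|n - m|%:Z by rewrite gez0_abs ?subr_ge0// addrCA subrr addr0.
rewrite expfzDr ?gt_eqF// ler_piMr ?exprz_ge0 ?(ltW e0)//.
by rewrite exprn_ile1// ltW.
Qed.

Let near_half : \forall eps \near to_zero, 2 * val (eps : epsI R) <= 1.
Proof.
by exists (2^-1) => [|eps /ltW]; rewrite ?invr_gt0// mulrC -ler_pdivlMr ?div1r.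
Qed.

Let exp_double (eps : epsI R) (n : int) : 2 * val eps <= 1 ->
  val eps ^ n + val eps ^ n <= val eps ^ (n - 1).
Proof.
case: eps => e /= /andP[e0 e1] e2.
rewrite -mulr2n -mulr_natl -{1}[n](subrK 1) expfzDr ?gt_eqF// expr1z mulrCA.
by rewrite ler_piMr// exprz_ge0// ltW.
Qed.

Section Module.
Variable E : normedModType K.
Implicit Types x y : epsI R -> E.

Definition moderate : {pred epsI R -> E} := fun x => `[< exists n : int,
  \forall eps \near to_zero, `|x eps| <= of_real k (val eps ^ n) >].

Fact moderate_zmod : zmod_closed moderate.
Proof.
split=> [|x y /asboolP[m xm] /asboolP[n yn]]; apply/asboolP.
  exists 0; near=> eps; rewrite normr0 expr0z of_real1; exact: ler01.
exists (Num.min m n - 1); near=> eps.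
rewrite (le_trans (ler_normB _ _))//.
rewrite (@le_trans _ _ (of_real k (val eps ^ m) + of_real k (val eps ^ n)))//.
  by apply: lerD; [near: eps; exact: xm|near: eps; exact: yn].
rewrite -of_realD ler_of_real (le_trans _ (exp_double _ _))//.
  by rewrite lerD// ler_exp// ge_min lexx// orbT.
by near: eps; exact: near_half.
Unshelve. all: by end_near. Qed.
HB.instance Definition _ := GRing.isZmodClosed.Build (epsI R -> E) moderate
  moderate_zmod.

Record mod_net := ModNet { net :> epsI R -> E ; _ : net \in moderate }.

HB.instance Definition _ := [isSub of mod_net for net].
HB.instance Definition _ := [Choice of mod_net by <:].
HB.instance Definition _ := [SubChoice_isSubZmodule of mod_net by <:].

Definition null : {pred mod_net} := fun x : mod_net => `[< forall q : nat,
  \forall eps \near to_zero, `|x eps| <= of_real k (val eps ^+ q) >].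

Fact null_zmod : zmod_closed null.
Proof.
split=> [|x y /asboolP x0 /asboolP y0]; apply/asboolP => q.
  near=> eps; rewrite normr0 -of_real0 ler_of_real exprn_ge0//.
  by have /andP[/ltW] := valP eps.
near=> eps; rewrite (le_trans (ler_normB _ _))//.
rewrite (@le_trans _ _
  (of_real k (val eps ^+ q.+1) + of_real k (val eps ^+ q.+1)))//.
  by apply: lerD; [near: eps; exact: x0|near: eps; exact: y0].
rewrite -of_realD ler_of_real.
have -> : val eps ^+ q = val eps ^ (q.+1%:Z - 1) by rewrite -addn1 PoszD addrK.
apply: (@exp_double eps q.+1%:Z); near: eps; exact: near_half.
Unshelve. all: by end_near. Qed.
HB.instance Definition _ := GRing.isZmodClosed.Build mod_net null null_zmod.

Definition colombeau := {ideal_quot null}.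

HB.instance Definition _ := ZmodQuotient.on colombeau.

(* The class of a net; junk value 0 if the net is not moderate. *)
Definition cls (x : epsI R -> E) : colombeau :=
  \pi_colombeau (insubd (0 : mod_net) x).

End Module.
Arguments moderate : clear implicits.
Arguments null : clear implicits.

Fact moderate_mul : mulr_closed (moderate K^o).
Proof.
split=> [|x y /asboolP[m xm] /asboolP[n yn]]; apply/asboolP.
  by exists 0; near=> eps; rewrite normr1 expr0z of_real1.
exists (m + n); near=> eps; have /andP[e0 _] := valP eps.
rewrite normrM expfzDr ?gt_eqF// of_realM ler_pM//.
  by near: eps; exact: xm.
by near: eps; exact: yn.
Unshelve. all: by end_near. Qed.
HB.instance Definition _ := GRing.isMulClosed.Build (epsI R -> K^o)
  (moderate K^o) moderate_mul.
HB.instance Definition _ := [SubZmodule_isSubNzRing of mod_net K^o by <:].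
HB.instance Definition _ := [SubNzRing_isSubComNzRing of mod_net K^o by <:].

Fact null_ideal : idealr_closed (null K^o).
Proof.
split; [exact: (@null_zmod K^o).1| |].
  apply/negP => /asboolP/(_ 1) one0.
  have [eps [/= + e2]] := filter_ex (filterI one0 near_half).
  by rewrite normr1 -of_real1 ler_of_real expr1 => e1; lra.
move=> a x y /asboolP x0 y0; rewrite -[y]opprK.
apply: (@null_zmod K^o).2; last by rewrite -sub0r (@null_zmod K^o).2// (@null_zmod K^o).1.
apply/asboolP => q; have /asboolP[n an] := valP a.
near=> eps; have /andP[e0 _] := valP eps.
rewrite normrM.
have -> : val eps ^+ q = val eps ^ n * val eps ^ (q%:Z - n).
  by rewrite -expfzDr ?gt_eqF// addrCA subrr addr0.
rewrite of_realM ler_pM//; first by near: eps; exact: an.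
apply: (@le_trans _ _ (of_real k (val eps ^+ `|q%:Z - n|%N))).
  by near: eps; exact: x0.
by rewrite ler_of_real; apply: (@ler_exp eps _ `|q%:Z - n|%N); rewrite abszE ler_norm.
Unshelve. all: by end_near. Qed.
HB.instance Definition _ := isIdealr.Build (mod_net K^o) (null K^o) null_ideal.

Definition gnum := colombeau K^o.
HB.instance Definition _ := GRing.ComNzRing.copy gnum {ideal_quot (null K^o)}.

End Colombeau.

Arguments colombeau : clear implicits.
Arguments mod_net : clear implicits.
Arguments moderate {R} k E x.
Arguments null {R} k E x.
Arguments cls {R} k E x.

(* The set of cluster points, as eps --> 0, of any representative of p *)
Definition num_supp (R : realType) (k : scalars) (p : gnum R k) :
    set (scal R k)^o :=
  [set q | exists x : epsI R -> (scal R k)^o,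
    [/\ moderate k _ x, cls k _ x = p &
      exists2 s : nat -> epsI R, val (s n) @[n --> \oo] --> (0 : R) &
        x (s n) @[n --> \oo] --> q]].

Section GeneralizedOperators.
Variables (R : realType) (H : hilbertType R).
Local Notation G_H := (colombeau R ComplexScalars H).
Local Notation C_bar := (gnum R ComplexScalars).
Implicit Types (T : G_H -> G_H) (Te : epsI R -> bop H).

Definition represents Te T : Prop :=
  moderate ComplexScalars (bop H) Te /\
  forall x : epsI R -> H, moderate ComplexScalars H x ->
    T (cls ComplexScalars H x) = cls ComplexScalars H (fun eps => Te eps (x eps)).

(* Membership in B(G_H); the witness need not be a distinguished net of T. *)
Definition compactly_supported T : Prop :=
  exists2 Te, represents Te T &
    exists K : set (bop H), compact K /\
      exists eta : epsI R, forall eps, val eps < val eta -> K (Te eps).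

Definition gdot (x y : G_H) : C_bar :=
  cls ComplexScalars R[i]^o (fun eps => hdot (repr x eps) (repr y eps)).

Definition gselfadjoint T : Prop :=
  forall x y : G_H, gdot (T x) y = gdot x (T y).

(* e . T ~ e . T0; the choice of the representatives of e and T is immaterial. *)
Definition approx_on (e : C_bar) T (T0 : bop H) : Prop :=
  exists (ee : epsI R -> R[i]^o) Te,
    [/\ moderate ComplexScalars R[i]^o ee, cls ComplexScalars R[i]^o ee = e,
      represents Te T &
      `|ee eps *: (Te eps - T0)| @[eps --> to_zero] --> (0 : R[i]^o)].

Definition op_supp T : set (bop H) :=
  [set T0 | exists e : C_bar, [/\ e * e = e, e != 0 & approx_on e T T0]].

Definition nu (u v : H) (A : bop H) : R :=
  Normc.normc (hdot u (bop_exp ('i%C *: A) v)).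

Definition gnu (u v : H) Te : gnum R RealScalars :=
  cls RealScalars R^o (fun eps => nu u v (Te eps)).

End GeneralizedOperators.

(* Main.v *)
From HB Require Import structures.
Require Import Defs.
From mathcomp Require Import all_boot all_order all_algebra.
From mathcomp Require Import complex.
From mathcomp Require Import sesquilinear ring_quotient.
From mathcomp Require Import lra.
From mathcomp Require Import all_classical all_reals all_analysis.

Import Order.TTheory GRing.Theory Num.Theory.
Import numFieldNormedType.Exports.

Local Open Scope classical_set_scope.
Local Open Scope ring_scope.

(* Two representatives of [T] differ by a net that is null in operator norm, as
   one sees by testing on vectors of the unit ball attaining half the norm. An idempotent
   that is nonzero in the ring of generalized numbers stays above 1/2 in absolute
   value along some sequence tending to 0; conversely the indicator of a sequence
   tending to 0 is such an idempotent. So the support of [T] is the set of limits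
   of [Te (s n)] over sequences [s n] tending to 0. Since the exponential is
   Lipschitz on bounded sets, [nu] is continuous, so it maps the support of [T]
   into that of [nu T]. Conversely, if [nu (Te (s n))] tends to [q], compactness
   yields a subsequence along which [Te] converges, and its limit [T0] satisfies
   [nu T0 = q]. *)

(** * Real scalars inside [R[i]], and norm bounds passing to limits *)

Lemma normr_real_complex (R : realType) (x : R) : `|x%:C%C| = `|x|%:C%C :> R[i].
Proof. by rewrite normc_def /= expr0n addr0 sqrtr_sqr. Qed.

Lemma cvg_norm_le (K : numFieldType) (V : normedModType K) (T : Type)
    (F : set_system T) (FF : ProperFilter F) (f : T -> V) (l : V) (c : K) :
  f @ F --> l -> (\forall t \near F, `|f t| <= c) -> `|l| <= c.
Proof.
move=> fl fc; apply/ler_addgt0Pr => e e0.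
have [t [/= ft lt]] := filter_ex (filterI fc (cvgr_dist_le _ _ fl _ e0)).
by rewrite -(subrKC (f t) l) (le_trans (ler_normD _ _))// lerD// distrC.
Qed.

(** * Completeness of the space of bounded operators *)

Section BopComplete.
Variables (R : realType) (H : completeNormedModType R[i]).

Lemma bop_ball_dist (A B : bop H) (e : R[i]) : ball A e B -> `|A - B| < e.
Proof. by rewrite -ball_normE. Qed.

Lemma bop_norm_le (A : bop H) (c : R[i]) :
  0 <= c -> (forall x, `|A x| <= c * `|x|) -> `|A| <= c.
Proof.
move=> c0 Ac; have cE : c = (complex.Re c)%:C%C.
  by case: c c0 {Ac} => a b; rewrite lecE /= => /andP[/eqP-> _].
rewrite bop_normE cE lecR opnorm_le -?cE// -?ler0c -?cE//.
Qed.

(** A Cauchy filter of operators is Cauchy at each [x], and [H] is complete. The pointwise limit [L]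
    is linear and bounded, and the estimate [Lle], uniform in [x], upgrades pointwise to norm
    convergence. Convergence of the exponential series rests on this. *)
Lemma bop_cauchy_cvg (F : set_system (bop H)) :
  ProperFilter F -> cauchy F -> cvg F.
Proof.
move=> FF /cauchy_ballP cF.
have cE (e : R[i]) : 0 < e ->
    exists2 P : set (bop H), F P &
      forall A B : bop H, P A -> P B -> `|A - B| < e.
  move=> e0; have [[P Q] /= [FP FQ] PQ] := cF e e0.
  exists (P `&` Q); first exact: filterI.
  by move=> A B [PA _] [_ QB]; exact: bop_ball_dist (PQ (A, B) (conj PA QB)).
have cx x : cvg ((fun A : bop H => A x) @ F).
  apply/cauchy_cvgP/cauchy_exP => e e0.
  (* The [+ 1] keeps the denominator positive when [x = 0]. *)
  have [|P FP Pe] := cE (e / (`|x| + 1)); first by rewrite divr_gt0// ltr_wpDl.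
  have [A PA] := filter_ex FP.
  exists (A x); rewrite -[_ (ball _ _)]/(F [set B : bop H | ball (A x) e (B x)]).
  apply: filterS FP => B PB /=.
  rewrite -ball_normE /= -[_ - _]/((A - B) x).
  rewrite (le_lt_trans (bop_normP _ _))//.
  rewrite (@le_lt_trans _ _ (e / (`|x| + 1) * `|x|))//.
    by rewrite ler_wpM2r// ltW// Pe.
  by rewrite mulrAC ltr_pdivrMr ?ltr_wpDl// ltr_pM2l// ltrDl.
pose L x := lim ((fun A : bop H => A x) @ F).
have Llim x : (fun A : bop H => A x) @ F --> L x by exact: cx.
(* With [A] fixed, [B] runs to the limit along [F] in the bound on [A x - B x]. *)
have Lle (e : R[i]) (P : set (bop H)) (A : bop H) :
    F P -> (forall B : bop H, P B -> `|A - B| < e) ->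
    forall x, `|A x - L x| <= e * `|x|.
  move=> FP AP x.
  have c : (fun B : bop H => A x - B x) @ F --> A x - L x.
    by apply: cvgB => //; exact: cvg_cst.
  apply: cvg_norm_le c _.
  apply: filterS FP => B PB /=.
  rewrite -[_ - _]/((A - B) x) (le_trans (bop_normP _ _))//.
  by rewrite ler_wpM2r// ltW// AP.
have Llin : linear L.
  move=> a x y; apply: (cvg_unique _ (Llim _)) => //.
  rewrite (_ : (fun A : bop H => _) = (fun A : bop H => a *: A x + A y)).
    by apply: cvgD => //; apply: cvgZr.
  by apply/funext => A; rewrite linearP.
have Lb : bounded_linear L.
  split=> //.
  have [P FP Pe] := cE 1 ltr01.
  have [A PA] := filter_ex FP.
  exists (`|A| + 1) => x; rewrite -(subrKC (A x) (L x)).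
  rewrite (le_trans (ler_normD _ _))// mulrDl lerD ?bop_normP//.
  by rewrite distrC; apply: Lle FP _ _ => B PB; exact: Pe.
have LP : L \in @bop_pred R H by apply/asboolP.
apply/cvg_ex; exists (Bop LP); apply/cvgrPdist_le => e e0.
have [P FP Pe] := cE e e0.
apply: filterS (FP) => A PA; rewrite distrC.
apply: bop_norm_le => [|x]; first exact: ltW.
by apply: (Lle e P A FP) => B PB; exact: Pe.
Qed.

HB.instance Definition _ :=
  Uniform_isComplete.Build (bop H) bop_cauchy_cvg.

End BopComplete.

Local Open Scope ring_scope.

(** * The operator exponential and its Lipschitz bound on balls *)

Section BopExp.
Variables (R : realType) (H : completeNormedModType R[i]).
Implicit Types A B : bop H.

Lemma bop_normM (A B : bop H) : `|A * B| <= `|A| * `|B|.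
Proof.
apply: bop_norm_le => [|x]; first by rewrite mulr_ge0.
by rewrite (le_trans (bop_normP A (B x)))// -mulrA ler_wpM2l ?bop_normP.
Qed.

Lemma bop_norm1 : `|1 : bop H| <= 1.
Proof. by apply: bop_norm_le => // x; rewrite mul1r. Qed.

Lemma bop_normX (A : bop H) (r : R[i]) n : `|A| <= r -> `|A ^+ n| <= r ^+ n.
Proof.
move=> Ar; elim: n => [|n IH]; first by rewrite !expr0 bop_norm1.
by rewrite !exprS (le_trans (bop_normM _ _))// ler_pM.
Qed.

(** Induction on the noncommutative splitting $A^{n+1}-B^{n+1} = A^n(A-B) + (A^n-B^n)B$. For [n = 0]
    the factor [n%:R] makes the exponent [n.-1] harmless. *)
Lemma bop_distX (A B : bop H) (r : R[i]) n : `|A| <= r -> `|B| <= r ->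
  `|A ^+ n - B ^+ n| <= n%:R * r ^+ n.-1 * `|A - B|.
Proof.
move=> Ar Br; have r0 : 0 <= r by exact: le_trans Ar.
elim: n => [|n IH]; first by rewrite !expr0 subrr normr0 !mul0r.
rewrite (_ : _ - _ = A ^+ n * (A - B) + (A ^+ n - B ^+ n) * B); last first.
  by rewrite mulrBr mulrBl !exprSr addrA subrK.
have -> : n.+1%:R * r ^+ n * `|A - B| =
    r ^+ n * `|A - B| + n%:R * r ^+ n * `|A - B|.
  by rewrite mulrSr !mulrDl mul1r addrC.
rewrite (le_trans (ler_normD _ _))// lerD//.
  by rewrite (le_trans (bop_normM _ _))// ler_wpM2r// bop_normX.
rewrite (le_trans (bop_normM _ _))// (le_trans (ler_pM _ _ IH Br))//.
rewrite mulrAC; case: n {IH} => [|n]; first by rewrite !mul0r.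
by rewrite -[X in X * `|A - B|]mulrA -exprSr.
Qed.

(** Names the term of the series in [bop_exp], to be compared with the real [exp_coeff]. *)
Definition bop_exp_coeff A n : bop H := (n`!%:R : R[i])^-1 *: A ^+ n.

Lemma bop_exp_coeff_norm A (r : R) n : `|A| <= r%:C%C ->
  `|bop_exp_coeff A n| <= (exp_coeff r n)%:C%C.
Proof.
move=> Ar; rewrite normrZ normfV normr_nat /exp_coeff/=.
rewrite rmorphM rmorphXn fmorphV rmorph_nat mulrC ler_wpM2r ?invr_ge0//.
exact: bop_normX.
Qed.

(** The factor $n+1$ from [bop_distX] cancels against $(n+1)!$, whence the shift of index. *)
Lemma bop_exp_coeff_dist A B (r : R) n : `|A| <= r%:C%C -> `|B| <= r%:C%C ->
  `|bop_exp_coeff A n.+1 - bop_exp_coeff B n.+1| <=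
  (exp_coeff r n)%:C%C * `|A - B|.
Proof.
move=> Ar Br; rewrite -scalerBr normrZ normfV normr_nat.
rewrite (@le_trans _ _ ((n.+1`!%:R)^-1 * (n.+1%:R * r%:C%C ^+ n * `|A - B|)))//.
  by rewrite ler_wpM2l ?invr_ge0// bop_distX.
rewrite /exp_coeff/= rmorphM rmorphXn fmorphV rmorph_nat !mulrA ler_wpM2r//.
by rewrite factS natrM invfM [_^-1 * _]mulrC mulfVK ?pnatr_eq0// mulrC.
Qed.

(** The series is Cauchy, being dominated termwise by the real exponential series at the norm of
    [A]. *)
Lemma bop_exp_cvg A : series (bop_exp_coeff A) @ \oo --> bop_exp A.
Proof.
have -> : bop_exp A = limn (series (bop_exp_coeff A)) by [].
apply/cauchy_cvgP/cauchy_seriesP => e e0.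
have [a Aa] : exists a : R, `|A| = a%:C%C by exists (opnorm A).
have a0 : 0 <= a by rewrite -ler0c -Aa.
have eE : e = (complex.Re e)%:C%C by rewrite RRe_real// gtr0_real.
have re0 : 0 < complex.Re e by rewrite -ltcR -eE.
have /cauchy_cvgP/cauchy_seriesP/(_ _ re0) := is_cvg_series_exp_coeff a.
apply: filterS => -[m n] /= smn; rewrite eE.
rewrite (@le_lt_trans _ _ (\sum_(m <= k < n) exp_coeff a k)%:C%C)//.
  rewrite rmorph_sum/= (le_trans (ler_norm_sum _ _ _))// ler_sum// => k _.
  by rewrite bop_exp_coeff_norm// Aa.
by rewrite ltcR (le_lt_trans _ smn)// ler_norm.
Qed.

Lemma bop_exp_lipschitz A B (r : R) : `|A| <= r%:C%C -> `|B| <= r%:C%C ->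
  `|bop_exp A - bop_exp B| <= (expR r)%:C%C * `|A - B|.
Proof.
move=> Ar Br; have r0 : 0 <= r by rewrite -ler0c (le_trans _ Ar).
have c : (fun n => series (bop_exp_coeff A) n - series (bop_exp_coeff B) n)
    @ \oo --> bop_exp A - bop_exp B by apply: cvgB; exact: bop_exp_cvg.
apply: cvg_norm_le c _; apply: nearW => -[|n].
  by rewrite !seriesEnat /= !big_geq// subrr normr0 mulr_ge0// ler0c expR_ge0.
(* The terms of index 0 cancel; those of index [k.+1] are bounded through [exp_coeff r k]. *)
rewrite !seriesEnat /= -sumrB big_nat_recl//= {1 2}/bop_exp_coeff !expr0 subrr.
rewrite add0r (le_trans (ler_norm_sum _ _ _))//.
rewrite (@le_trans _ _ ((series (exp_coeff r) n)%:C%C * `|A - B|))//.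
  rewrite seriesEnat rmorph_sum mulr_suml ler_sum// => k _.
  exact: bop_exp_coeff_dist.
rewrite ler_wpM2r// lecR.
apply: nondecreasing_cvgn_le; last exact: is_cvg_series_exp_coeff.
by apply: nondecreasing_series => k _ _; rewrite exp_coeff_ge0.
Qed.

End BopExp.

(** * Lipschitz bound for [nu] *)

Section Nu.
Variables (R : realType) (H : hilbertType R).

(** Bessel's inequality for one unit vector: expand the squared norm of [y - hdot y u *: u]. *)
Lemma hdot_unit_le (u y : H) : `|u| = 1 -> `|hdot u y| <= `|y|.
Proof.
move=> u1; rewrite (hermC hdot) expr0 mul1r norm_conjC.
have := hdot_norm (y - hdot y u *: u).
rewrite dnormB dnormZ !hdot_norm u1 expr1n mulr1.
rewrite linearZr_LR /= mulrC -normCK conj_Creal ?normrX ?realX ?normr_real//.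
move=> E.
rewrite -(ler_pXn2r (n:=2))// ?nnegrE// -subr_ge0.
suff -> : `|y| ^+ 2 - `|hdot y u| ^+ 2 = `|y - hdot y u *: u| ^+ 2.
  by rewrite exprn_ge0.
by rewrite -E opprD addrA addrK.
Qed.

Lemma nu_normE (u v : H) A :
  (nu u v A)%:C%C = `|hdot u (bop_exp ('i%C *: A) v)| :> R[i].
Proof. by []. Qed.

(** Multiplication by $i$ preserves the norm, so the bound for the exponential applies with the same
    [r]; pairing with unit vectors does not enlarge it. *)
Lemma nu_lipschitz (u v : H) (A B : bop H) (r : R) : `|u| = 1 -> `|v| = 1 ->
  opnorm A <= r -> opnorm B <= r ->
  `|nu u v A - nu u v B| <= expR r * opnorm (A - B).
Proof.
move=> u1 v1 Ar Br.
have i1 (C : bop H) : `|'i%C *: C| = `|C|.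
  by rewrite normrZ normc_def /= expr0n expr1n add0r sqrtr1 mul1r.
rewrite -lecR -normr_real_complex rmorphB /= !nu_normE (le_trans (ler_dist_dist _ _))//.
rewrite -linearBr (le_trans (hdot_unit_le _ _ u1))//.
rewrite -[_ - _]/((bop_exp ('i%C *: A) - bop_exp ('i%C *: B)) v).
rewrite (le_trans (bop_normP _ _))// v1 mulr1 rmorphM /= -bop_normE.
rewrite -[`|A - B|]i1 scalerBr; apply: bop_exp_lipschitz; rewrite i1.
  by rewrite bop_normE lecR.
by rewrite bop_normE lecR.
Qed.
End Nu.

(** * Classes of moderate nets, and sequences of indices tending to 0 *)

Lemma cls_eqP (R : realType) (k : scalars) (E : normedModType (scal R k))
    (x y : epsI R -> E) : moderate k E x -> moderate k E y ->
  cls k E x = cls k E y <-> forall q : nat,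
    \forall eps \near to_zero, `|x eps - y eps| <= of_real k (val eps ^+ q).
Proof.
move=> mx my.
have iE z : moderate k E z -> (insubd (0 : mod_net R k E) z : epsI R -> E) = z.
  exact: insubdK.
have -> : cls k E x = cls k E y <->
    insubd (0 : mod_net R k E) x - insubd 0 y \in null k E.
  rewrite Quotient.idealrBE; split=> [/eqP|] //; exact: eqP.
split=> [/asboolP N q|N].
  by have := N q; rewrite /= !iE.
by apply/asboolP => q; have := N q; rewrite /= !iE.
Qed.

(** The exponent $-1$ suffices, since $M \le \varepsilon^{-1}$ for small $\varepsilon$. *)
Lemma moderate_bounded (R : realType) (k : scalars)
    (E : normedModType (scal R k)) (x : epsI R -> E) (M : R) :
  (\forall eps \near to_zero, `|x eps| <= of_real k M) -> moderate k E x.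
Proof.
move=> xM; apply/asboolP; exists (-1).
have [N0|N0] := leP M 1.
  apply: filterS xM => eps /le_trans; apply; rewrite ler_of_real.
  have /andP[e0 e1] := valP eps.
  by rewrite (le_trans N0)// exprN1 invf_ge1.
have M0 : 0 < M by rewrite (lt_trans _ N0).
apply: filterS2 xM (_ : \forall eps \near to_zero, val eps < M^-1) => [eps|].
  move=> /le_trans xM eM; apply: xM; rewrite ler_of_real exprN1.
  have /andP[e0 _] := valP eps.
  by rewrite -[M]invrK lef_pV2 ?posrE ?invr_gt0// ltW.
by exists M^-1; rewrite ?invr_gt0.
Qed.

Lemma cls0 (R : realType) (k : scalars) (E : normedModType (scal R k)) :
  cls k E 0 = 0.
Proof.
rewrite -(pi_zeror (s := colombeau R k E)); congr (\pi_(_) _)%qT.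
apply: val_inj; rewrite /= val_insubd.
by case: ifP.
Qed.

Lemma clsM (R : realType) (k : scalars) (x y : epsI R -> (scal R k)^o) :
  moderate k _ x -> moderate k _ y ->
  cls k _ x * cls k _ y = cls k _ (x * y) :> gnum R k.
Proof.
move=> mx my.
rewrite -[LHS](rmorphM (\pi_(gnum R k))%qT).
congr (\pi_(_) _)%qT; apply: val_inj => /=.
rewrite !insubdK//.
exact: (rpredM (s := moderate k (scal R k)^o)).
Qed.

Lemma seq_to_zero (R : realType) (s : nat -> epsI R) :
  val (s n) @[n --> \oo] --> (0 : R) -> s @ \oo --> to_zero.
Proof.
move=> s0 P [eta eta0 etaP].
have : \forall n \near \oo, val (s n) < eta by exact: cvgr_lt s0 _ eta0.
by apply: filterS => n; exact: etaP.
Qed.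

Lemma near_to_zero_lt (R : realType) (eta : R) : 0 < eta ->
  \forall eps \near to_zero, val (eps : epsI R) < eta.
Proof. by move=> eta0; exists eta. Qed.

Lemma cvg_to_zero_harmonic (R : realType) (s : nat -> epsI R) :
  (forall n, val (s n) < n.+1%:R^-1) -> val (s n) @[n --> \oo] --> (0 : R).
Proof.
move=> sn; apply: (squeeze_cvgr _ (cvg_cst _) (@cvg_harmonic R)).
apply: nearW => n; have /andP[s0 _] := valP (s n).
by rewrite (ltW s0) ltW.
Qed.

(** * The operator norm as a real-valued function *)

Section Opnorm.
Variables (R : realType) (H : normedModType R[i]).
Implicit Types A B C : bop H.

Lemma opnorm_distC A B : opnorm (A - B) = opnorm (B - A).
Proof.
by apply: (fmorph_inj (real_complex R)); rewrite /= -!bop_normE distrC.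
Qed.

Lemma opnorm_distD B A C : opnorm (A - C) <= opnorm (A - B) + opnorm (B - C).
Proof. by rewrite -lecR rmorphD /= -!bop_normE ler_distD. Qed.

Lemma opnorm_dist A B : `|opnorm A - opnorm B| <= opnorm (A - B).
Proof.
by rewrite -lecR -normr_real_complex rmorphB /= -!bop_normE ler_dist_dist.
Qed.

Lemma opnorm_le_dist A B : opnorm A <= opnorm B + opnorm (A - B).
Proof. by rewrite -lerBlDl (le_trans (ler_norm _)) ?opnorm_dist. Qed.

Lemma nbhs_opnorm A (e : R) : 0 < e -> nbhs A [set B | opnorm (A - B) < e].
Proof.
move=> e0; apply/nbhs_ballP; exists e%:C%C; first by rewrite /= (ltcR 0).
by move=> B; rewrite -ball_normE /= bop_normE ltcR.
Qed.

Lemma opnorm_continuous : continuous (@opnorm R H : bop H -> R^o).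
Proof.
move=> A; apply/(@cvgrPdist_le _ _ _ _ (nbhs_filter A)) => e e0.
apply: (@filterS _ _ (nbhs_filter A)) (nbhs_opnorm A _ e0) => B /ltW.
exact: le_trans (opnorm_dist _ _).
Qed.

Lemma compact_opnorm_bounded (K : set (bop H)) : compact K ->
  exists M : R, forall A, K A -> opnorm A <= M.
Proof.
move=> Kc.
have /compact_bounded : compact ((@opnorm R H : bop H -> R^o) @` K).
  apply: continuous_compact => //; apply: continuous_subspaceT.
  exact: opnorm_continuous.
move=> [M [Mr MK]]; exists (M + 1) => A KA.
rewrite (le_trans (ler_norm _))// (MK (M + 1)) ?ltrDl//; exists A.
Qed.

(** The supremum need not be attained, hence the factor 2. *)
Lemma opnorm_adherent A : exists x : H, `|x| <= 1 /\ `|A| <= 2 * `|A x|.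
Proof.
have [->|A0] := eqVneq A 0.
  by exists 0; rewrite !normr0 ler01 mulr_ge0.
have oA : 0 < opnorm A by rewrite -ltcR -bop_normE normr_gt0.
have : opnorm A / 2 < opnorm A by rewrite ltr_pdivrMr// ltr_pMr// ltr1n.
move=> /sup_gt [|_ [x x1 <-] xA].
  by exists (complex.Re `|A 0|), 0 => //=; rewrite normr0 ler01.
exists x; split=> //.
rewrite bop_normE -[`|A x|]RRe_real ?normr_real//.
by rewrite -(rmorph_nat (real_complex R)) -rmorphM lecR mulrC -ler_pdivrMr// ltW.
Qed.

End Opnorm.

(** * Comparison of two representatives of an operator *)

Section Represents.
Variables (R : realType) (H : hilbertType R).
Local Notation G_H := (colombeau R ComplexScalars H).
Implicit Types (T : G_H -> G_H) (A B : epsI R -> bop H).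

Lemma represents_null T A B : represents A T -> represents B T ->
  forall q : nat, \forall eps \near to_zero,
    opnorm (A eps - B eps) <= val eps ^+ q.
Proof.
move=> [mA AT] [mB BT] q.
have [x xP] := choice (fun eps => opnorm_adherent _ _ (A eps - B eps)).
have x1 eps : `|x eps| <= 1 by have [] := xP eps.
have mx : moderate ComplexScalars H x.
  by apply: (moderate_bounded _ _ _ _ 1); apply: nearW.
have mCx C : moderate ComplexScalars (bop H) C ->
    moderate ComplexScalars H (fun eps => C eps (x eps)).
  move=> /asboolP[n Cn]; apply/asboolP; exists n.
  apply: filterS Cn => eps; apply: le_trans.
  by rewrite (le_trans (bop_normP _ _))// ler_piMr.
have := AT _ mx; rewrite BT//.
(* The extra power of [eps] absorbs the factor 2 of [opnorm_adherent] once [eps < 1/2]. *)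
move=> /esym/(cls_eqP _ _ _ _ _ (mCx _ mA) (mCx _ mB))/(_ q.+1) ABq.
apply: filterS2 ABq (near_to_zero_lt R _ (_ : 0 < 2^-1)) => [eps|]; last first.
  by rewrite invr_gt0.
move=> ABx e2; have [_ AB] := xP eps; have /andP[e0 _] := valP eps.
rewrite -lecR -bop_normE (le_trans AB)//.
rewrite (@le_trans _ _ (2 * (val eps ^+ q.+1)%:C%C))// ?ler_wpM2l//.
rewrite -(rmorph_nat (real_complex R)) -rmorphM lecR exprS mulrA.
by rewrite ler_piMl ?exprn_ge0 ?(ltW e0)// mulrC -ler_pdivlMr// div1r ltW.
Qed.

Lemma compactly_supported_bounded T A : compactly_supported T ->
  represents A T -> exists M : R, \forall eps \near to_zero, opnorm (A eps) <= M.
Proof.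
move=> [B rB [K [Kc [eta etaK]]]] rA.
have [M MK] := compact_opnorm_bounded _ _ _ Kc.
(* Only [B] is known to stay in [K]; nullness with exponent 0 puts [A] within 1 of it. *)
exists (M + 1); have := represents_null _ _ _ rA rB 0.
apply: filterS2 (near_to_zero_lt R _ (_ : 0 < val eta)) => [eps /etaK/MK BM AB|].
  by rewrite (le_trans (opnorm_le_dist _ _ _ (B eps)))// lerD.
by have /andP[] := valP eta.
Qed.

End Represents.

(** * Subsequences in compact sets of operators *)

Lemma cvgn_ge_id (t : nat -> nat) : (forall n, (n <= t n)%N) -> t @ \oo --> \oo.
Proof.
move=> tn P [N _ NP]; exists N => // n /= Nn.
by apply: NP; rewrite /= (leq_trans Nn).
Qed.

(** For each [k], some index [t k >= k] comes within $1/(k+1)$ of a cluster point. The map [t] is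
    not claimed to be increasing; it only has to tend to infinity. *)
Lemma compact_cvg_subseq (R : realType) (H : normedModType R[i])
    (K : set (bop H)) (A : nat -> bop H) :
  compact K -> (\forall n \near \oo, K (A n)) ->
  exists (T0 : bop H) (t : nat -> nat), t @ \oo --> \oo /\
    opnorm (A (t n) - T0) @[n --> \oo] --> (0 : R).
Proof.
move=> Kc KA.
have [T0 [_ clT0]] := Kc (A @ \oo) _ KA.
have tP k : exists n, (k <= n)%N /\ opnorm (T0 - A n) < k.+1%:R^-1.
  have [||_ [[n kn <-] AnT0]] := clT0 (A @` [set n | (k <= n)%N])
    [set B | opnorm (T0 - B) < k.+1%:R^-1]; last by exists n.
    by exists k => // n /= kn; exists n.
  by apply: nbhs_opnorm; rewrite invr_gt0.
have [t tk] := choice tP.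
exists T0, t; split; first by apply: cvgn_ge_id => n; have [] := tk n.
apply: (squeeze_cvgr _ (cvg_cst _) (@cvg_harmonic R)).
apply: nearW => n; rewrite opnorm_ge0/= opnorm_distC ltW//.
by have [] := tk n.
Qed.

(** * Continuity and moderateness of [nu] *)

Section Nu.
Variables (R : realType) (H : hilbertType R) (u v : H).

Lemma nu_cvg (A : nat -> bop H) (T0 : bop H) : `|u| = 1 -> `|v| = 1 ->
  opnorm (A n - T0) @[n --> \oo] --> (0 : R) ->
  nu u v (A n) @[n --> \oo] --> nu u v T0.
Proof.
move=> hu hv AT0; apply/cvgrPdist_le => e e0.
(* A common bound for [T0] and, eventually, all [A n]. *)
pose r := opnorm T0 + 1.
have d0 : 0 < e / expR r by rewrite divr_gt0 ?expR_gt0.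
have c1 : \forall n \near \oo, opnorm (A n - T0) <= 1 
  by exact: cvgr_le AT0 _ ltr01.
have c2 : \forall n \near \oo, opnorm (A n - T0) <= e / expR r.
  exact: cvgr_le AT0 _ d0.
apply: filterS2 c1 c2 => n An1 Ane.
rewrite distrC (le_trans (nu_lipschitz _ _ _ _ _ _ r hu hv _ _))//.
- by rewrite (le_trans (opnorm_le_dist _ _ _ T0))// lerD2l.
- by rewrite lerDl.
- by rewrite mulrC -ler_pdivlMr ?expR_gt0.
Qed.

Lemma nu_moderate (A : epsI R -> bop H) (M : R) : `|u| = 1 -> `|v| = 1 ->
  (\forall eps \near to_zero, opnorm (A eps) <= M) ->
  moderate RealScalars R^o (fun eps => nu u v (A eps)).
Proof.
move=> hu hv AM; apply: (moderate_bounded _ _ _ _ (`|nu u v 0| + expR M * M)).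
apply: filterS AM => eps AM /=.
have o0 : opnorm (0 : bop H) = 0.
  by apply: (fmorph_inj (real_complex R)); rewrite /= -bop_normE normr0.
rewrite -[nu u v (A eps)](subrKC (nu u v 0)) (le_trans (ler_normD _ _))// lerD2l.
rewrite (le_trans (nu_lipschitz _ _ _ _ _ _ M hu hv _ _))//.
  by rewrite o0 (le_trans _ AM) ?opnorm_ge0.
by rewrite subr0 ler_wpM2l ?expR_ge0.
Qed.

End Nu.

(** * Supports of generalized numbers, and nonzero idempotents *)

(** Representatives eventually differ by at most [eps], so they have the same limits along [s]; one
    fixed representative is enough. *)
Lemma num_suppP (R : realType) (x : epsI R -> R^o) (q : R) :
  moderate RealScalars R^o x ->
  num_supp (cls RealScalars R^o x) q <-> exists2 s : nat -> epsI R,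
    val (s n) @[n --> \oo] --> (0 : R) & x (s n) @[n --> \oo] --> q.
Proof.
move=> mx; split=> [[y [my /(cls_eqP _ _ _ _ _ my mx) yx [s s0 yq]]]|[s s0 xq]].
  exists s => //.
  have d0 : (y (s n) - x (s n)) @[n --> \oo] --> (0 : R^o).
    apply/norm_cvg0P; apply: (squeeze_cvgr _ (cvg_cst _) s0).
    have : \forall n \near \oo, `|y (s n) - x (s n)| <= val (s n) ^+ 1.
      exact: (seq_to_zero _ _ s0 _ (yx 1)).
    by apply: filterS => n; rewrite expr1 normr_ge0.
  rewrite -[q]subr0 (_ : (fun n => _) = (fun n => y (s n) - (y (s n) - x (s n)))).
    exact: (@cvgB _ R^o).
  by apply/funext => n; rewrite subKr.
by exists x; split=> //; exists s.
Qed.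

(** If $|e|<1/2$ on all of [P], then $|e-1|\ge 1/2$ there, so $|e|\le 2|e^2-e|$ is null and the
    class vanishes. *)
Lemma idempotent_ge_half (R : realType) (k : scalars)
    (e : epsI R -> (scal R k)^o) : moderate k _ e ->
  cls k _ e * cls k _ e = cls k _ e :> gnum R k -> cls k _ e != 0 :> gnum R k ->
  forall P : set (epsI R), to_zero P ->
  exists eps, P eps /\ 2^-1 <= `|e eps|.
Proof.
move=> me ee e0 P P0; apply: contrapT => /forallNP nP; move/negP: e0; apply.
have m0 : moderate k (scal R k)^o 0 by exact: (rpred0 (moderate k (scal R k)^o)).
apply/eqP; rewrite -(cls0 R k (scal R k)^o); apply/cls_eqP => // q.
have mee : moderate k (scal R k)^o (e * e).
  exact: (rpredM (s := moderate k (scal R k)^o)).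
move: ee; rewrite clsM// => /(cls_eqP _ _ _ _ _ mee me)/(_ q.+1) eeq.
have h0 : 0 < 2^-1 :> R by rewrite invr_gt0.
apply: filterS3 P0 eeq (near_to_zero_lt R _ h0) => eps Pe eeq e2.
rewrite subr0.
have ltv : `|e eps| < 2^-1.
  rewrite real_ltNge ?realV ?normr_real ?realn//.
  by apply/negP => he; apply: (nP eps); split.
have ge2 : 2^-1 <= `|e eps - 1|.
  rewrite -[_ - 1]opprB normrN (le_trans _ (lerB_dist _ _))// normr1.
  rewrite lerBrDr (le_trans (lerD (lexx _) (ltW ltv)))//.
  by rewrite [X in _ <= X](splitr 1) div1r.
have : `|e eps| * `|e eps - 1| <= of_real k (val eps ^+ q.+1).
  by rewrite -normrM mulrBr mulr1.
have /andP[eps0 _] := valP eps.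
move=> /(le_trans (ler_wpM2l (normr_ge0 _) ge2)).
rewrite ler_pdivrMr// => /le_trans; apply.
have -> : 2 = of_real k 2 :> scal R k by rewrite -[2]/(1 + 1) of_realD of_real1.
rewrite -of_realM ler_of_real exprS mulrAC ler_piMl ?exprn_ge0 ?(ltW eps0)//.
by rewrite -ler_pdivlMr// div1r ltW.
Qed.

(** Used to turn a small value [s n] into a large index: below [eta], [n] is at least [N]. *)
Lemma seq_lower_bound (R : realType) (s : nat -> epsI R) (N : nat) :
  exists2 eta : R, 0 < eta & forall n, (n < N)%N -> eta <= val (s n).
Proof.
elim: N => [|N [eta eta0 IH]]; first by exists 1.
have /andP[sN0 _] := valP (s N).
exists (Num.min eta (val (s N))); first by rewrite lt_min eta0.
move=> n; rewrite ltnS leq_eqVlt => /predU1P[->|/IH nN].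
  by rewrite ge_min lexx orbT.
by rewrite ge_min nN.
Qed.

(** * The support of an operator through sequences *)

Section OpSupp.
Variables (R : realType) (H : hilbertType R).
Local Notation G_H := (colombeau R ComplexScalars H).
Implicit Types (T : G_H -> G_H) (A B : epsI R -> bop H).

Lemma op_supp_cvg T A (T0 : bop H) : represents A T -> op_supp T T0 ->
  exists2 s : nat -> epsI R, val (s n) @[n --> \oo] --> (0 : R) &
    opnorm (A (s n) - T0) @[n --> \oo] --> (0 : R).
Proof.
move=> rA [c [ee e0 [e [B [me ec rB eB]]]]]; rewrite -{}ec in ee e0.
(* Where $|e|\ge 1/2$, the net [B] is within $2/(k+1)$ of [T0]; passing from [B] to [A] costs
   another $1/(k+1)$. *)
have sP k : exists eps : epsI R,
    [/\ val eps < k.+1%:R^-1 & opnorm (A eps - T0) <= 3 * k.+1%:R^-1].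
  have k0 : 0 < k.+1%:R^-1 :> R by rewrite invr_gt0.
  have kC : 0 < (k.+1%:R^-1)%:C%C :> R[i] by rewrite (ltcR 0).
  have eBk : \forall t \near to_zero,
      `|0 - `|e t *: (B t - T0)| : R[i]^o| < (k.+1%:R^-1)%:C%C.
    exact: (@cvgr_dist_lt R[i] R[i]^o _ _ _ _ _ eB _ kC).
  have [eps [[[Be epsk] AB] ge2]] := idempotent_ge_half _ _ _ me ee e0 _
    (filterI (filterI eBk (near_to_zero_lt R _ k0))
             (represents_null _ _ _ _ _ rA rB 1)).
  exists eps; split=> //.
  rewrite (le_trans (opnorm_distD _ _ (B eps) _ _))//.
  rewrite expr1 in AB.
  have BT0 : opnorm (B eps - T0) <= 2 * k.+1%:R^-1.
    move: Be => /ltW; rewrite sub0r normrN normr_id normrZ bop_normE.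
    move=> /(le_trans (ler_wpM2r _ ge2)); rewrite ler0c opnorm_ge0 => /(_ isT).
    rewrite ler_pdivrMl// -(rmorph_nat (real_complex R)) -rmorphM.
    by rewrite lecR.
  have -> : 3 * (k.+1%:R^-1 : R) = k.+1%:R^-1 + 2 * k.+1%:R^-1.
    by rewrite (natrD _ 1 2) mulrDl mul1r.
  by rewrite lerD// (le_trans AB)// ltW.
have [s sk] := choice sP.
exists s; first by apply: cvg_to_zero_harmonic => n; have [] := sk n.
have h3 : 3 * (n.+1%:R^-1 : R) @[n --> \oo] --> 0.
  rewrite -(mulr0 3); apply: cvgM; first exact: cvg_cst.
  exact: cvg_harmonic.
apply: (squeeze_cvgr _ (cvg_cst _) h3).
by apply: nearW => n; rewrite opnorm_ge0/=; have [] := sk n.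
Qed.

Lemma cvg_op_supp T A (T0 : bop H) (s : nat -> epsI R) : represents A T ->
  val (s n) @[n --> \oo] --> (0 : R) ->
  opnorm (A (s n) - T0) @[n --> \oo] --> (0 : R) -> op_supp T T0.
Proof.
move=> rA s0 AT0.
(* The indicator of the range of [s] is idempotent as a net. It is not null, since it equals 1 at
   arbitrarily small indices. *)
pose e : epsI R -> R[i]^o := fun eps => `[< range s eps >]%:R.
have me : moderate ComplexScalars R[i]^o e.
  apply: (moderate_bounded _ _ _ _ 1); apply: nearW => eps.
  by rewrite normr_nat /e; case: `[< _ >].
exists (cls ComplexScalars R[i]^o e); split.
- rewrite clsM//; congr cls; apply/funext => eps.
  by rewrite /e fctE; case: `[< _ >]; rewrite ?mulr1 ?mulr0.
- apply/eqP; rewrite -(cls0 R ComplexScalars R[i]^o).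
  have m0 : moderate ComplexScalars R[i]^o 0.
    exact: (rpred0 (moderate ComplexScalars R[i]^o)).
  move=> /(cls_eqP _ _ _ _ _ me m0)/(_ 1) e1.
  have h0 : 0 < 2^-1 :> R by rewrite invr_gt0.
  have sn : \forall n \near \oo, `|e (s n) - 0| <= (val (s n) ^+ 1)%:C%C /\
     val (s n) < 2^-1.
    exact: (seq_to_zero _ _ s0 _ (filterI e1 (near_to_zero_lt R _ h0))).
  have [n [+ sn2]] := filter_ex sn.
  rewrite /e asboolT ?subr0 ?normr1; last by exists n.
  rewrite (lecR 1) expr1; lra.
- exists e, A; split=> //; apply/(@cvgrPdist_lt R[i] R[i]^o) => d d0.
  have dE : d = (complex.Re d)%:C%C by rewrite RRe_real// gtr0_real.
  have rd0 : 0 < complex.Re d by rewrite -ltcR -dE.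
  have [N _ NA] : \forall n \near \oo, opnorm (A (s n) - T0) < complex.Re d.
    exact: cvgr_lt AT0 _ rd0.
  (* Below [eta], an index either lies off the range, where [e] vanishes, or is some [s n] with
     [n >= N]. *)
  have [eta eta0 etas] := seq_lower_bound R s N.
  exists eta => // eps epse.
  rewrite sub0r normrN normr_id normrZ /e.
  have [[n _ sn]|_] := asboolP; last by rewrite normr0 mul0r.
  rewrite normr1 mul1r bop_normE dE ltcR -sn NA//=.
  by rewrite leqNgt; apply/negP => /etas; rewrite sn leNgt epse.
Qed.

End OpSupp.

Theorem theorem5p15 (R : realType) (H : hilbertType R)
    (hH : infinite_dimensional H)
    (u v : H) (huv : hdot u v = 0) (hu : `|u| = 1) (hv : `|v| = 1)
    (T : colombeau R ComplexScalars H -> colombeau R ComplexScalars H)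
    (Te : epsI R -> bop H)
    (hT : compactly_supported T) (hTe : represents Te T)
    (hTsa : gselfadjoint T)
    (hTesa : forall eps : epsI R, bop_selfadjoint (Te eps)) :
  num_supp (gnu u v Te) = [set nu u v T0 | T0 in op_supp T].
Proof.
have [M TeM] := compactly_supported_bounded _ _ _ _ hT hTe.
have mnu := nu_moderate _ _ _ _ _ _ hu hv TeM.
(* The net [B] that stays in [K] may differ from [Te]: compactness is applied to [B], and the limit
   is carried over to [Te] by nullness of the difference. *)
have [B rB [K [Kc [eta etaK]]]] := hT.
apply/seteqP; split=> [q /(num_suppP _ _ _ mnu)[s s0 sq]|_ [T0 T0T <-]].
  have KBs : \forall n \near \oo, K (B (s n)).
    have /andP[eta0 _] := valP eta.
    have : \forall n \near \oo, val (s n) < val eta.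
      exact: (seq_to_zero _ _ s0 _ (near_to_zero_lt R _ eta0)).
    by apply: filterS => n; exact: etaK.
  have [T0 [t [tn BT0]]] := compact_cvg_subseq _ _ _ _ Kc KBs.
  have st0 : val (s (t n)) @[n --> \oo] --> (0 : R) by exact: cvg_comp tn s0.
  have TeT0 : opnorm (Te (s (t n)) - T0) @[n --> \oo] --> (0 : R).
    have b : val (s (t n)) + opnorm (B (s (t n)) - T0) @[n --> \oo] --> (0 : R).
      have := @cvgD R R^o _ _ _ _ _ _ _ st0 BT0; rewrite addr0; exact.
    apply: (squeeze_cvgr _ (cvg_cst _) b).
    have : \forall n \near \oo, opnorm (Te (s (t n)) - B (s (t n))) <=
        val (s (t n)) ^+ 1.
      exact: (seq_to_zero _ (s \o t) st0 _ (represents_null _ _ _ _ _ hTe rB 1)).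
    apply: filterS => n TB; rewrite opnorm_ge0/=.
    by rewrite (le_trans (opnorm_distD _ _ (B (s (t n))) _ _))// lerD2r.
  exists T0; first exact: (cvg_op_supp _ _ _ _ _ (s \o t) hTe st0 TeT0).
  have c1 := nu_cvg _ _ _ _ _ _ hu hv TeT0.
  have c2 : nu u v (Te (s (t n))) @[n --> \oo] --> q by exact: cvg_comp tn sq.
  exact: cvg_unique c1 c2.
have [s s0 sT0] := op_supp_cvg _ _ _ _ _ hTe T0T.
apply/(num_suppP _ _ _ mnu); exists s => //.
exact: nu_cvg.
Qed.
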